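(* Let $\mathbb{T}$ be a time scale, $a,b\in\mathbb{T}$ with $a<b$, $c,d\in\mathbb{R}$, $\alpha\in[0,1]$, $g\in C([a,b]_{\mathbb{T}},(c,d))$ and $h\in C([a,b]_{\mathbb{T}},\mathbb{R})$ with $$\int_a^b|h(s)|\Diamond_\alpha s>0.$$ If $f\in C((c,d),\mathbb{R})$ is convex, then $$f\left(\frac{\int_a^b|h(s)|g(s)\Diamond_\alpha s}{\int_a^b|h(s)|\Diamond_\alpha s}\right)\le\frac{\int_a^b|h(s)|f(g(s))\Diamond_\alpha s}{\int_a^b|h(s)|\Diamond_\alpha s}.$$
   Context: A time scale is a nonempty closed subset of $\mathbb{R}$; $[a,b]_{\mathbb{T}}=[a,b]\cap\mathbb{T}$; $\sigma(t)=\inf\{s\in\mathbb{T}:s>t\}$, $\rho(t)=\sup\{s\in\mathbb{T}:s<t\}$. The $\Delta$-derivative $f^\Delta(t)$ satisfies: for each $\varepsilon>0$, $|f(\sigma(t))-f(s)-f^\Delta(t)(\sigma(t)-s)|\le\varepsilon|\sigma(t)-s|$ for $s$ near $t$; the $\nabla$-derivative is defined likewise with $\rho$ in place of $\sigma$. $\int_a^bf\Delta t=F(b)-F(a)$ with $F^\Delta=f$, and $\int_a^bf\nabla t=H(b)-H(a)$ with $H^\nabla=f$. For $0\le\alpha\le1$ the $\Diamond_\alpha$-integral is $\int_a^bf(s)\Diamond_\alpha s=\alpha\int_a^bf(s)\Delta s+(1-\alpha)\int_a^bf(s)\nabla s$. $C(X,Y)$ denotes continuous functions. *)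

(* Defs.v *)
From HB Require Import structures.
From mathcomp Require Import all_boot all_order all_algebra.
From mathcomp Require Import all_classical all_reals all_analysis.
Set Implicit Arguments.
Unset Strict Implicit.
Unset Printing Implicit Defensive.
Import Order.TTheory GRing.Theory Num.Theory.
Import numFieldNormedType.Exports.
Local Open Scope classical_set_scope.
Local Open Scope ring_scope.

(* A function on a time scale T (or on [a, b]_T) is
   represented by a function R -> R of which only the values on T (resp. on
   [a, b]_T) are meaningful. *)

Definition time_scale (R : realType) (T : set R) : Prop :=
  T !=set0 /\ closed T.

Definition ts_itv (R : realType) (T : set R) (a b : R) : set R :=
  `[a, b] `&` T.

(* In the library inf and sup of the empty set are 0; the else-branches
   implement the usual time-scale conventions inf set0 = sup T and
   sup set0 = inf T, i.e. sigma fixes the maximum of T (if any) and rho its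
   minimum (if any). *)
Definition ts_sigma (R : realType) (T : set R) (t : R) : R :=
  let A := [set s | T s /\ t < s] in
  if `[< A !=set0 >] then inf A else sup T.

Definition ts_rho (R : realType) (T : set R) (t : R) : R :=
  let A := [set s | T s /\ s < t] in
  if `[< A !=set0 >] then sup A else inf T.

Definition is_delta_derive (R : realType) (T : set R) (F : R -> R)
    (t l : R) : Prop :=
  forall e : R, 0 < e -> \forall s \near within T (nbhs t),
    `|F (ts_sigma T t) - F s - l * (ts_sigma T t - s)|
      <= e * `|ts_sigma T t - s|.

Definition is_nabla_derive (R : realType) (T : set R) (F : R -> R)
    (t l : R) : Prop :=
  forall e : R, 0 < e -> \forall s \near within T (nbhs t),
    `|F (ts_rho T t) - F s - l * (ts_rho T t - s)|
      <= e * `|ts_rho T t - s|.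

(* At a left-scattered maximum of T (the point excluded from T^kappa) every
   number is a delta derivative, so the condition is void there; dually for
   nabla at a right-scattered minimum. *)
Definition delta_antiderivative (R : realType) (T : set R) (a b : R)
    (f F : R -> R) : Prop :=
  forall t, ts_itv T a b t -> is_delta_derive T F t (f t).

Definition nabla_antiderivative (R : realType) (T : set R) (a b : R)
    (f H : R -> R) : Prop :=
  forall t, ts_itv T a b t -> is_nabla_derive T H t (f t).

(* For a <= b in T the increment F b - F a does not depend on the choice of
   the antiderivative; the value is the default 0 if there is none. *)
Definition delta_int (R : realType) (T : set R) (a b : R) (f : R -> R) : R :=
  xget 0 [set I | exists2 F, delta_antiderivative T a b f F & I = F b - F a].

Definition nabla_int (R : realType) (T : set R) (a b : R) (f : R -> R) : R :=
  xget 0 [set I | exists2 H, nabla_antiderivative T a b f H & I = H b - H a].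

Definition diamond_int (R : realType) (T : set R) (alpha a b : R)
    (f : R -> R) : R :=
  alpha * delta_int T a b f + (1 - alpha) * nabla_int T a b f.

(* Main.v *)
Require Import Defs.
From HB Require Import structures.
From mathcomp Require Import all_boot all_order all_algebra.
From mathcomp Require Import all_classical all_reals all_analysis.
From mathcomp Require Import measurable_realfun lra ring.
Import Order.TTheory GRing.Theory Num.Theory.
Import numFieldNormedType.Exports.
Local Open Scope classical_set_scope.
Local Open Scope ring_scope.

(** The diamond integral is a linear functional on the functions continuous on
    [[a, b]_T], nonnegative on nonnegative functions, and Jensen's inequality
    for such a functional is the support-line argument. Write [H], [G], [F] for
    the integrals of [|h|], [|h| g], [|h| (f o g)], and [m = G / H].
    By compactness [g] takes a least and a greatest value on [[a, b]_T], both
    inside [(c, d)], so positivity gives [c < m < d]. Then [f] has a support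
    line at [m], [f m + k * (y - m) <= f y] ([convex_support_line]);
    integrating it at [y = g s] with weight [|h s|] gives
    [f m * H + k * (G - m * H) <= F], and the middle term vanishes.

    The integrals being defined through antiderivatives, linearity and
    positivity rest on two facts about a continuous [f].
    - An antiderivative exists ([delta_antiderivative_exists]). Fill each gap
      of the time scale with the value of [f] at the left end of the gap; the
      Lebesgue indefinite integral of the resulting function on the line is a
      delta antiderivative of [f].
    - A function with nonnegative delta derivative increases from [a] to [b]
      ([delta_antiderivative_le]), which makes the integral independent of the
      antiderivative and positive.
    The nabla integral is the delta integral of the reflected function on the
    reflected time scale ([nabla_intE]), so that it inherits both. *)

Set Implicit Arguments.
Unset Strict Implicit.
Unset Printing Implicit Defensive.

(** * Neighbourhoods, continuity and extrema on subsets of the line *)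

Lemma ts_itvP (R : realType) (T : set R) (a b t : R) :
  ts_itv T a b t <-> [/\ a <= t, t <= b & T t].
Proof.
rewrite /ts_itv /= in_itv /=; split; first by case=> /andP[].
by case=> -> ->.
Qed.

Lemma within_nbhsP (R : realType) (T P : set R) (t : R) :
  (\forall s \near within T (nbhs t), P s) <->
  exists2 r : R, 0 < r & forall s, T s -> `|s - t| < r -> P s.
Proof.
rewrite near_withinE; split.
- move=> /nbhs_ballP[r /= r0 H]; exists r => // s Ts st; apply: (H s) => //.
  by rewrite /ball /= distrC.
- move=> [r r0 H]; apply/nbhs_ballP; exists r => // s.
  by rewrite /ball /= distrC => /[swap]; exact: H.
Qed.

Lemma within_continuousP (R : realType) (K : set R) (f : R -> R) :
  {within K, continuous f} <->
  forall t, K t -> forall e, 0 < e -> exists2 r : R, 0 < r &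
    forall s, K s -> `|s - t| < r -> `|f s - f t| < e.
Proof.
rewrite subspace_continuousP; split => H t Kt.
- move=> e e0; have /cvgrPdist_lt/(_ e e0)/within_nbhsP[r r0 h] := H t Kt.
  by exists r => // s Ks st; rewrite distrC; exact: h.
- apply/cvgrPdist_lt => e e0; have [r r0 h] := H t Kt e e0.
  by apply/within_nbhsP; exists r => // s Ks st; rewrite distrC; exact: h.
Qed.

Lemma closed_mem_sup (R : realType) (A B : set R) :
  closed B -> A `<=` B -> has_sup A -> B (sup A).
Proof.
move=> cB AB sA; apply: cB => U /nbhs_ballP[e /= e0 eU].
have [x Ax xe] := sup_adherent e0 sA; exists x; split; first exact: AB.
apply: eU; have xs : x <= sup A by apply: ub_le_sup => //; case: sA.
by rewrite /ball /= ltr_distlC; apply/andP; split; lra.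
Qed.

Lemma closed_mem_inf (R : realType) (A B : set R) :
  closed B -> A `<=` B -> has_inf A -> B (inf A).
Proof.
move=> cB AB iA; apply: cB => U /nbhs_ballP[e /= e0 eU].
have [x Ax xe] := inf_adherent e0 iA; exists x; split; first exact: AB.
apply: eU; have ix : inf A <= x by apply: ge_inf => //; case: iA.
by rewrite /ball /= ltr_distlC; apply/andP; split; lra.
Qed.

(** * The forward jump operator *)

Lemma ts_sigma_le (R : realType) (T : set R) (t s : R) :
  T s -> t < s -> ts_sigma T t <= s.
Proof.
move=> Ts ts; rewrite /ts_sigma; case: asboolP => [_|]; last first.
  by case; exists s.
by apply: ge_inf => //; exists t => x [_ /ltW].
Qed.

Lemma ts_sigma_ge (R : realType) (T : set R) (t : R) :
  T t -> t <= ts_sigma T t.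
Proof.
move=> Tt; rewrite /ts_sigma; case: asboolP => [A0|A0].
  by apply: lb_le_inf => // x [_ /ltW].
apply: ub_le_sup => //; exists t => x Tx; rewrite leNgt; apply/negP => tx.
by apply: A0; exists x.
Qed.

Lemma ts_sigma_mem (R : realType) (T : set R) (t : R) :
  time_scale T -> T t -> T (ts_sigma T t).
Proof.
move=> [T0 cT] Tt; rewrite /ts_sigma; case: asboolP => [A0|A0].
  apply: (closed_mem_inf cT) => [x []//|].
  by split=> //; exists t => x [_ /ltW].
apply: (closed_mem_sup cT) => //; split => //.
exists t => x Tx; rewrite leNgt; apply/negP => tx.
by apply: A0; exists x.
Qed.

Lemma ts_itv_compact (R : realType) (T : set R) (a b : R) :
  time_scale T -> compact (ts_itv T a b).
Proof.
move=> [_ cT]; rewrite /ts_itv setIC; apply: subclosed_compact.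
- by apply: closedI => //; exact: itv_closed.
- exact: (@segment_compact _ a b).
- exact: subIsetr.
Qed.

(** * Delta derivatives *)

Lemma is_delta_deriveP (R : realType) (T : set R) (F : R -> R) (t l : R) :
  is_delta_derive T F t l <->
  forall e, 0 < e -> exists2 r : R, 0 < r & forall s, T s -> `|s - t| < r ->
    `|F (ts_sigma T t) - F s - l * (ts_sigma T t - s)|
      <= e * `|ts_sigma T t - s|.
Proof. by split=> H e e0; apply/within_nbhsP; exact: H. Qed.

Lemma is_delta_derive_lin (R : realType) (T : set R) (F G : R -> R)
    (k t l m : R) :
  is_delta_derive T F t l -> is_delta_derive T G t m ->
  is_delta_derive T (fun x => F x + k * G x) t (l + k * m).
Proof.
move=> /is_delta_deriveP HF /is_delta_deriveP HG.
apply/is_delta_deriveP => e e0; have k0 : 0 < 1 + `|k| by rewrite ltr_wpDr.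
have [r r0 hF] := HF (e / 2) ltac:(by rewrite divr_gt0).
have [q q0 hG] := HG (e / 2 / (1 + `|k|)) ltac:(by rewrite !divr_gt0).
exists (Num.min r q); first by rewrite lt_min r0.
move=> s Ts; rewrite lt_min => /andP[/(hF _ Ts) {}hF /(hG _ Ts) {}hG].
set S := ts_sigma T t in hF hG *.
have -> : F S + k * G S - (F s + k * G s) - (l + k * m) * (S - s) =
  (F S - F s - l * (S - s)) + k * (G S - G s - m * (S - s)) by ring.
apply: (le_trans (ler_normD _ _)).
rewrite [e](_ : _ = e / 2 + e / 2) ?mulrDl; last lra.
apply: lerD => //; rewrite normrM.
apply: (@le_trans _ _ ((1 + `|k|) * (e / 2 / (1 + `|k|) * `|S - s|))).
  by apply: ler_pM => //; rewrite lerDr.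
rewrite le_eqVlt; apply/orP; left; apply/eqP; field.
by apply/eqP => h; move: k0; rewrite h ltxx.
Qed.

(** The point [s = t] itself is admissible in the definition, where the bound
    holds for every [e > 0]; so the increment over the jump is exactly
    [l * mu], whether or not [t] is right-scattered. *)
Lemma delta_derive_jump (R : realType) (T : set R) (F : R -> R) (t l : R) :
  T t -> is_delta_derive T F t l ->
  F (ts_sigma T t) = F t + l * (ts_sigma T t - t).
Proof.
move=> Tt /is_delta_deriveP H; set S := ts_sigma T t in H *.
apply/eqP; rewrite -subr_eq0 -normr_le0; apply/ler_addgt0Pl => e e0.
have p : 0 < 1 + `|S - t| by rewrite ltr_wpDr.
have [r r0 h] := H (e / (1 + `|S - t|)) ltac:(by rewrite divr_gt0).
have := h t Tt; rewrite subrr normr0 => /(_ r0).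
rewrite addr0 opprD addrA => /le_trans; apply.
by rewrite -mulrA ger_pMr// mulrC ler_pdivrMr// mul1r lerDr.
Qed.

(** By [delta_derive_jump] the increment [F s - F t] is the error term of the
    derivative plus [l * (s - t)], and the factor [|sigma t - s|] in the error
    bound stays below [sigma t - t + 1] near [t]. *)
Lemma delta_derive_continuous (R : realType) (T : set R) (F : R -> R)
    (t l : R) :
  T t -> is_delta_derive T F t l ->
  forall e, 0 < e -> exists2 r : R, 0 < r &
    forall s, T s -> `|s - t| < r -> `|F s - F t| <= e.
Proof.
move=> Tt Ft e e0; have FS := delta_derive_jump Tt Ft.
move: Ft => /is_delta_deriveP H; set S := ts_sigma T t in H FS *.
set m := `|S - t| + 1; have m0 : 0 < m by rewrite ltr_wpDl.
have e1 : 0 < e / (2 * m) by rewrite divr_gt0// mulr_gt0.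
have [r r0 h] := H _ e1.
have l1 : 0 < 1 + `|l| by rewrite ltr_wpDr.
have e2 : 0 < e / (2 * (1 + `|l|)) by rewrite divr_gt0// mulr_gt0.
exists (Num.min r (Num.min 1 (e / (2 * (1 + `|l|))))).
  by rewrite !lt_min r0 ltr01 e2.
move=> s Ts; rewrite !lt_min => /and3P[/(h _ Ts) {}h st1 st].
have -> : F s - F t = - (F S - F s - l * (S - s)) + l * (s - t).
  by rewrite FS; ring.
rewrite (le_trans (ler_normD _ _))// normrN.
rewrite [e](_ : _ = e / 2 + e / 2); last lra.
apply: lerD.
  apply: (le_trans h).
  have Ss : `|S - s| <= m.
    have -> : S - s = (S - t) - (s - t) by ring.
    by apply: (le_trans (ler_normB _ _)); rewrite lerD2l ltW.
  apply: (le_trans (ler_wpM2l (ltW e1) Ss)); rewrite le_eqVlt; apply/orP; left.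
  by apply/eqP; field; exact: lt0r_neq0.
rewrite normrM; apply: (@le_trans _ _ ((1 + `|l|) * (e / (2 * (1 + `|l|))))).
  by apply: ler_pM => //; [rewrite lerDr|exact: ltW].
rewrite le_eqVlt; apply/orP; left.
by apply/eqP; field; exact: lt0r_neq0.
Qed.

(** * Monotonicity and uniqueness of antiderivatives *)

Lemma right_dense_approx (R : realType) (T : set R) (t b r : R) :
  ts_sigma T t = t -> T b -> t < b -> 0 < r ->
  exists2 x, T x & t < x < t + r.
Proof.
rewrite /ts_sigma => + Tb tb r0; case: asboolP => [A0 it|]; last first.
  by case; exists b.
have iA : has_inf [set s | T s /\ t < s] by split=> //; exists t => x [_ /ltW].
have [x [Tx tx]] := inf_adherent r0 iA; rewrite it => xr.
by exists x => //; rewrite tx.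
Qed.

(** The mean value inequality. For [e > 0] let [m] be the supremum of the
    points up to which [F s >= F a - e * (s - a)] holds on the time scale.
    Continuity of [F] passes the inequality to [m]. If [m < b] then it extends
    past [m]: by the jump formula when [m] is right-scattered, by the derivative
    estimate with tolerance [e] when it is right-dense; so [m = b], and [e]
    tends to [0]. *)
Lemma delta_antiderivative_le (R : realType) (T : set R) (a b : R)
    (f F : R -> R) :
  time_scale T -> T a -> T b -> a <= b -> delta_antiderivative T a b f F ->
  (forall t, ts_itv T a b t -> 0 <= f t) -> F a <= F b.
Proof.
move=> tsT Ta Tb ab dF f0; set K := ts_itv T a b.
suff H e : 0 < e -> F a - e * (b - a) <= F b.
  apply/ler_addgt0Pl => e e0; have p : 0 < b - a + 1 by lra.
  have := H _ (divr_gt0 e0 p); suff : e / (b - a + 1) * (b - a) <= e by lra.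
  rewrite -[leRHS]mulr1 -mulrA ler_pM2l// mulrC ler_pdivrMr//; lra.
move=> e0; pose good s := F a - e * (s - a) <= F s.
pose S := [set t | K t /\ forall s, K s -> s <= t -> good s].
have Ka : K a by apply/ts_itvP.
have Sa : S a.
  split=> // s /ts_itvP[sa _ _] sa'; have -> : s = a by apply/le_anti/andP.
  by rewrite /good; lra.
have supS : has_sup S.
  by split; [exists a|exists b => x [/ts_itvP[]]].
set m := sup S.
have Sm x : S x -> x <= m by move=> Sx; apply: ub_le_sup => //; case: supS.
have am : a <= m by exact: Sm.
have mb : m <= b by apply: ge_sup => [|x [/ts_itvP[]]//]; exists a.
have near_m r : 0 < r -> exists x, [/\ S x, m - r < x & x <= m].
  move=> r0; have [x Sx xr] := sup_adherent r0 supS; exists x; split => //.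
  exact: Sm.
have Tm : T m.
  by apply: (closed_mem_sup tsT.2) supS => x [/ts_itvP[]].
have Km : K m by apply/ts_itvP.
have gm : good m.
  apply/ler_addgt0Pl => n n0.
  have [r r0 h] := delta_derive_continuous Tm (dF m Km) n0.
  have [x [[Kx gx] xr xm]] := near_m r r0.
  have [_ _ Tx] := (ts_itvP _ _ _ _).1 Kx.
  have := h x Tx; rewrite ltr_norml => /(_ ltac:(apply/andP; split; lra)).
  rewrite ler_norml => /andP[_ Fxm]; have := gx x Kx (lexx x); rewrite /good.
  have := ler_wpM2l (ltW e0) (lerB xm (lexx a)); lra.
have ltm s : K s -> s <= m -> good s.
  move=> Ks; rewrite le_eqVlt => /predU1P[->//|sm].
  have [x [[Kx gx] xr xm]] := near_m (m - s) ltac:(lra).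
  by apply: gx => //; lra.
move: mb; rewrite le_eqVlt => /predU1P[<-//|mb].
have fm := f0 m Km.
have := ts_sigma_ge Tm; rewrite le_eqVlt => /predU1P[mS|mS].
  have /is_delta_deriveP/(_ e e0)[r r0 h] := dF m Km.
  have q0 : 0 < Num.min r (b - m) by rewrite lt_min r0 subr_gt0.
  have [x Tx /andP[mx]] := right_dense_approx (esym mS) Tb mb q0.
  rewrite -ltrBlDl lt_min => /andP[xr xb].
  suff /Sm : S x by rewrite leNgt mx.
  split; first by apply/ts_itvP; split=> //; lra.
  move=> s Ks sx; have [sm|ms] := leP s m; first exact: ltm.
  have [_ _ Ts] := (ts_itvP _ _ _ _).1 Ks.
  have := h s Ts; rewrite -mS gtr0_norm ?subr_gt0// => /(_ ltac:(lra)).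
  rewrite [`|m - s|]distrC (gtr0_norm (_ : 0 < s - m)) ?subr_gt0//.
  rewrite ler_norml => /andP[_].
  have : 0 <= f m * (s - m) by rewrite mulr_ge0// subr_ge0 ltW.
  move: gm; rewrite /good; lra.
have FS := delta_derive_jump Tm (dF m Km).
suff /Sm : S (ts_sigma T m) by rewrite leNgt mS.
have Sb := ts_sigma_le Tb mb.
split; first by apply/ts_itvP; split=> //; [lra|exact: ts_sigma_mem].
move=> s Ks sS; have [sm|ms] := leP s m; first exact: ltm.
have [_ _ Ts] := (ts_itvP _ _ _ _).1 Ks.
have -> : s = ts_sigma T m by apply/le_anti; rewrite sS ts_sigma_le.
have : 0 <= f m * (ts_sigma T m - m) by rewrite mulr_ge0// subr_ge0 ltW.
have : 0 <= e * (ts_sigma T m - m) by rewrite mulr_ge0 ?subr_ge0 ?ltW.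
by move: gm; rewrite /good FS; lra.
Qed.

Lemma delta_antiderivative_lin (R : realType) (T : set R) (a b k : R)
    (f g F G : R -> R) :
  delta_antiderivative T a b f F -> delta_antiderivative T a b g G ->
  delta_antiderivative T a b (fun x => f x + k * g x) (fun x => F x + k * G x).
Proof.
by move=> dF dG t Kt; apply: is_delta_derive_lin; [exact: dF|exact: dG].
Qed.

(** Two antiderivatives of [f] differ by one of [0], whose increments are both
    nonnegative and nonpositive. *)
Lemma delta_intE (R : realType) (T : set R) (a b : R) (f F : R -> R) :
  time_scale T -> T a -> T b -> a <= b -> delta_antiderivative T a b f F ->
  delta_int T a b f = F b - F a.
Proof.
move=> tsT Ta Tb ab dF; apply: xget_unique; first by exists F.
have aux G H : delta_antiderivative T a b f G ->
    delta_antiderivative T a b f H -> G b - G a <= H b - H a.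
  move=> dG dH.
  have := delta_antiderivative_le tsT Ta Tb ab
    (delta_antiderivative_lin (-1) dH dG).
  move=> /(_ (fun t _ => ltac:(lra))); lra.
by move=> _ [G dG ->]; apply/le_anti; rewrite !aux.
Qed.

(** * Existence of antiderivatives *)

(** The retraction of the line onto [[a, b]_T] that sends a point of a gap to
    the left end of the gap. The maximum with [a] sends everything to the left
    of [a] to [a] itself, where the supremum would be of the empty set. *)
Definition ts_floor (R : realType) (T : set R) (a b x : R) : R :=
  sup [set s | ts_itv T a b s /\ s <= Num.max a x].

Lemma ts_floor_mem (R : realType) (T : set R) (a b x : R) :
  time_scale T -> T a -> a <= b -> ts_itv T a b (ts_floor T a b x).
Proof.
move=> tsT Ta ab; set A := [set s | ts_itv T a b s /\ s <= Num.max a x].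
have cA : closed A.
  have -> : A = ts_itv T a b `&` [set s | s <= Num.max a x] by [].
  apply: closedI; last exact: closed_le.
  by apply: closedI; [exact: itv_closed|exact: tsT.2].
have supA : has_sup A.
  split; last by exists b => s [/ts_itvP[]].
  by exists a; split; [exact/ts_itvP|rewrite le_max lexx].
by have [] := closed_mem_sup cA (@subset_refl _ A) supA.
Qed.

Lemma ts_floor_ge (R : realType) (T : set R) (a b x s : R) :
  ts_itv T a b s -> s <= x -> s <= ts_floor T a b x.
Proof.
move=> Ks sx; apply: ub_le_sup; first by exists b => y [/ts_itvP[]].
by split=> //; rewrite le_max sx orbT.
Qed.

Lemma ts_floor_le (R : realType) (T : set R) (a b x : R) :
  T a -> a <= b -> a <= x -> ts_floor T a b x <= x.
Proof.
move=> Ta ab ax; apply: ge_sup => [|s []].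
  by exists a; split; [exact/ts_itvP|rewrite le_max lexx].
by rewrite max_r.
Qed.

Lemma ts_floor_nondecreasing (R : realType) (T : set R) (a b : R) :
  T a -> a <= b -> nondecreasing_fun (ts_floor T a b).
Proof.
move=> Ta ab x y xy; apply: ge_sup => [|s [Ks sx]].
  by exists a; split; [exact/ts_itvP|rewrite le_max lexx].
apply: ub_le_sup; first by exists b => z [/ts_itvP[]].
by split=> //; apply: (le_trans sx); rewrite ge_max !le_max lexx xy orbT.
Qed.

Lemma lebesgue_measure_co (R : realType) (s t : R) : s <= t ->
  lebesgue_measure (`[s, t[%classic : set R) = (t - s)%:E.
Proof.
rewrite lebesgue_measure_itv /= lte_fin le_eqVlt => /predU1P[->|->].
  by rewrite ltxx subrr.
by rewrite -EFinB.
Qed.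

Lemma lebesgue_measure_co_lty (R : realType) (s t : R) :
  (lebesgue_measure (`[s, t[%classic : set R) < +oo)%E.
Proof.
by rewrite lebesgue_measure_itv /=; case: ifP => // _; rewrite -EFinD ltry.
Qed.

(** [ts_floor] is monotone, hence measurable, and takes values in a compact set
    on which [f] is continuous, hence measurable and bounded. *)
Lemma integrable_floor (R : realType) (T : set R) (a b : R) (f : R -> R)
    (s t : R) :
  time_scale T -> T a -> a <= b -> {within ts_itv T a b, continuous f} ->
  lebesgue_measure.-integrable `[s, t[ (EFin \o (f \o ts_floor T a b)).
Proof.
move=> tsT Ta ab cf; set K := ts_itv T a b.
have cK : compact K by exact: ts_itv_compact.
have fK x : K (ts_floor T a b x) by exact: ts_floor_mem.
apply: measurable_bounded_integrable.
- exact: measurable_itv.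
- exact: lebesgue_measure_co_lty.
- apply: (@measurable_comp _ _ _ _ _ _ K).
  + exact: compact_measurable.
  + by move=> _ [x _ <-].
  + apply: subspace_continuous_measurable_fun; last exact: cf.
    exact: compact_measurable.
  + by apply: nondecreasing_measurable => //; exact: ts_floor_nondecreasing.
- have [M [Mr HM]] := compact_bounded (continuous_compact cf cK).
  exists M; split=> // x Mx y _ /=; apply: (HM x Mx).
  by exists (ts_floor T a b y); first exact: fK.
Qed.

Lemma Rintegral_increment_le (R : realType) (u : R -> R) (p s t l e : R) :
  (forall x y, lebesgue_measure.-integrable `[x, y[ (EFin \o u)) ->
  p <= s -> s <= t -> (forall x, s <= x < t -> `|u x - l| <= e) ->
  `|(\int[lebesgue_measure]_(x in `[p, t[) u x
     - \int[lebesgue_measure]_(x in `[p, s[) u x) - l * (t - s)| <= e * (t - s).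
Proof.
move=> iu ps st ul.
have int_cst k : lebesgue_measure.-integrable `[s, t[ (EFin \o (fun=> k : R)).
  apply: measurable_bounded_integrable => //.
  - exact: lebesgue_measure_co_lty.
  - by exists `|k|; split=> // x kx y _ /=; exact: ltW.
have Rcst k : \int[lebesgue_measure]_(x in `[s, t[) k = k * (t - s).
  rewrite Rintegral_cst//; congr (_ * _).
  exact: (congr1 fine (lebesgue_measure_co st)).
have E : `[p, t[%classic = `[p, s[%classic `|` `[s, t[%classic :> set R.
  by apply: itv_bndbnd_setU; rewrite bnd_simp.
rewrite [X in (X - _ - _)](_ : _ = \int[lebesgue_measure]_(x in `[p, s[) u x
    + \int[lebesgue_measure]_(x in `[s, t[) u x); last first.
  rewrite E Rintegral_setU//; first by rewrite -E.
  apply/disj_setPS => x [/=]; rewrite !in_itv /= => /andP[_ xs] /andP[sx _].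
  by move: xs; rewrite ltNge sx.
rewrite [X in `|X - _|]addrAC subrr add0r -Rcst -RintegralB//.
have iB : lebesgue_measure.-integrable `[s, t[ (EFin \o (fun x => u x - l)).
  have -> : EFin \o (fun x => u x - l) = ((EFin \o u) \- (EFin \o (fun=> l)))%E.
    by apply/funext => x /=; rewrite EFinB.
  exact: integrableB.
rewrite -Rcst; apply: (le_trans (le_normr_Rintegral _ iB)) => //.
by apply: le_Rintegral => //; exact: (integrable_norm iB).
Qed.

(** On a gap [[t, sigma t[] the extension [f \o ts_floor] is constantly [f t],
    and at points close to [t] its value is a value of [f] at a point of the
    time scale close to [t]. So its indefinite Lebesgue integral has the
    increments that the delta derivative requires. *)
Lemma delta_antiderivative_exists (R : realType) (T : set R) (a b : R)
    (f : R -> R) :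
  time_scale T -> T a -> a <= b -> {within ts_itv T a b, continuous f} ->
  exists F, delta_antiderivative T a b f F.
Proof.
move=> tsT Ta ab cf; set K := ts_itv T a b; pose u := f \o ts_floor T a b.
have iu s t : lebesgue_measure.-integrable `[s, t[ (EFin \o u).
  exact: integrable_floor.
(* The base point lies left of [a] because the derivative at [a] also
   involves points of [T] slightly smaller than [a]. *)
exists (fun x => \int[lebesgue_measure]_(y in `[a - 1, x[) u y) => t Kt.
apply/is_delta_deriveP => e e0.
have [at_ tb Tt] := (ts_itvP _ _ _ _).1 Kt.
have [r r0 fr] := (within_continuousP _ _).1 cf t Kt e e0.
have tS := ts_sigma_ge Tt; set S := ts_sigma T t in tS *.
(* Right of a right-scattered [t], radius [S - t] leaves no point of [T]. *)
pose q := if t < S then Num.min r (S - t) else r.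
exists (Num.min 1 q).
  by rewrite lt_min ltr01 /q; case: ifP => // tS'; rewrite lt_min r0 subr_gt0.
move=> s Ts; rewrite lt_min => /andP[s1 sq].
have sr : `|s - t| < r.
  by move: sq; rewrite /q; case: ifP => // _; rewrite lt_min => /andP[].
have near x : `|ts_floor T a b x - t| < r -> `|u x - f t| <= e.
  by move=> xr; apply/ltW/fr => //; exact: ts_floor_mem.
have as1 : a - 1 <= s by move: s1; rewrite ltr_norml => /andP[]; lra.
have aS : a <= S by exact: le_trans tS.
have [sS|Ss] := leP s S.
  rewrite [in leRHS]ger0_norm ?subr_ge0//.
  apply: Rintegral_increment_le => // x /andP[sx xS]; apply: near.
  have [xt|tx] := ltP x t.
    have xT : ts_floor T a b x <= t.
      rewrite (le_trans (ts_floor_nondecreasing Ta ab (ltW xt)))//.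
      exact: ts_floor_le.
    have sx' : s <= ts_floor T a b x.
      have [sa|as_] := ltP s a.
        have [+ _ _] := (ts_itvP _ _ _ _).1 (ts_floor_mem x tsT Ta ab).
        by apply: le_trans; exact: ltW.
      by apply: ts_floor_ge => //; apply/ts_itvP; split=> //; lra.
    move: sr; rewrite !ltr_norml => /andP[? ?]; apply/andP; split; lra.
  have ax : a <= x by exact: le_trans tx.
  suff -> : ts_floor T a b x = t by rewrite subrr normr0.
  have [_ _ Tx] := (ts_itvP _ _ _ _).1 (ts_floor_mem x tsT Ta ab).
  apply/le_anti; rewrite (ts_floor_ge Kt tx) andbT leNgt; apply/negP => tf.
  have := ts_sigma_le Tx tf; rewrite leNgt => /negP; apply.
  exact: le_lt_trans (ts_floor_le Ta ab ax) xS.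
have St : S = t.
  apply/le_anti; rewrite tS andbT leNgt; apply/negP => tS'.
  move: sq; rewrite /q tS' lt_min => /andP[_].
  by rewrite ltr_norml => /andP[_]; lra.
move: Ss sq; rewrite {}St => ts _.
rewrite [`|t - s|]distrC (gtr0_norm (_ : 0 < s - t)) ?subr_gt0//.
set I := (X in `|_ - X - _|); set J := (X in `|X - _ - _|).
have -> : J - I - f t * (t - s) = - (I - J - f t * (s - t)) by ring.
rewrite normrN; apply: Rintegral_increment_le => //; [lra|exact: ltW|].
move=> x /andP[tx xs]; apply: near.
have ax : a <= x by exact: le_trans tx.
have := ts_floor_ge Kt tx; have := ts_floor_le Ta ab ax.
by move: sr; rewrite !ltr_norml => /andP[? ?] ? ?; apply/andP; split; lra.
Qed.

(** * Reflection of a time scale *)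

Definition ts_opp (R : realType) (T : set R) : set R := [set x | T (- x)].

Lemma ts_oppK (R : realType) (T : set R) (t : R) : ts_opp T (- t) = T t.
Proof. by rewrite /ts_opp /= opprK. Qed.

Lemma sup_opp (R : realType) (A : set R) : sup (ts_opp A) = - inf A.
Proof.
rewrite /inf opprK; congr sup; apply/seteqP; split => [x Ax|_ [x Ax <-]].
  by exists (- x); rewrite ?opprK.
by rewrite ts_oppK.
Qed.

Lemma inf_opp (R : realType) (A : set R) : inf (ts_opp A) = - sup A.
Proof.
rewrite -[A in RHS](_ : ts_opp (ts_opp A) = A) ?sup_opp ?opprK//.
by apply/funext => x; exact: ts_oppK.
Qed.

Lemma ts_sigma_opp (R : realType) (T : set R) (t : R) :
  ts_sigma (ts_opp T) (- t) = - ts_rho T t.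
Proof.
rewrite /ts_sigma /ts_rho.
have -> : [set s | ts_opp T s /\ - t < s] = ts_opp [set s | T s /\ s < t].
  by apply/funext => s; rewrite /ts_opp /= ltrNl.
have E : (ts_opp [set s | T s /\ s < t] !=set0)
    = ([set s | T s /\ s < t] !=set0).
  apply/propext; split => -[x h]; exists (- x) => //.
  by rewrite ts_oppK.
by rewrite E; case: asboolP => _; rewrite ?inf_opp ?sup_opp.
Qed.

Lemma time_scale_opp (R : realType) (T : set R) :
  time_scale T -> time_scale (ts_opp T).
Proof.
move=> [[x Tx] cT]; split; first by exists (- x); rewrite ts_oppK.
by apply: (closed_comp _ cT) => y _; exact: opp_continuous.
Qed.

Lemma ts_itv_opp (R : realType) (T : set R) (a b : R) :
  ts_itv (ts_opp T) (- b) (- a) = ts_opp (ts_itv T a b).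
Proof.
apply/seteqP; split => t.
  by move=> /ts_itvP[? ? ?]; apply/ts_itvP; split=> //; lra.
by move=> /ts_itvP[? ? ?]; apply/ts_itvP; split=> //; lra.
Qed.

(** The two signs in [- H (- x)] cancel in the slope, so the derivative keeps
    its value [l]. *)
Lemma is_nabla_derive_opp (R : realType) (T : set R) (H : R -> R) (t l : R) :
  is_nabla_derive T H t l <->
  is_delta_derive (ts_opp T) (fun x => - H (- x)) (- t) l.
Proof.
have E s e :
  (`|H (ts_rho T t) - H s - l * (ts_rho T t - s)| <= e * `|ts_rho T t - s|) =
  (`|- H (- ts_sigma (ts_opp T) (- t)) - - H (- - s)
     - l * (ts_sigma (ts_opp T) (- t) - - s)|
     <= e * `|ts_sigma (ts_opp T) (- t) - - s|).
  rewrite ts_sigma_opp !opprK.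
  by congr (_ <= _); [|congr (_ * _)]; rewrite -[LHS]normrN; congr (`|_|); ring.
rewrite is_delta_deriveP; split => h e e0.
- have /within_nbhsP[r r0 {}h] := h e e0; exists r => // s Ts st.
  have := h (- s) Ts; rewrite E [- - s]opprK; apply.
  by rewrite -normrN opprD opprK.
- have [r r0 {}h] := h e e0; apply/within_nbhsP; exists r => // s Ts st.
  rewrite E; apply: h; first by rewrite ts_oppK.
  by rewrite -normrN opprD !opprK.
Qed.

(** The nabla theory on [T] is the delta theory on the reflected time scale;
    every property of [nabla_int] below is read off from this. *)
Lemma nabla_intE (R : realType) (T : set R) (a b : R) (f : R -> R) :
  nabla_int T a b f = delta_int (ts_opp T) (- b) (- a) (fun x => f (- x)).
Proof.
rewrite /nabla_int /delta_int; congr xget; apply/seteqP; split => I /=.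
- move=> [H dH ->]; exists (fun x => - H (- x)); last by rewrite !opprK addrC.
  move=> t; rewrite ts_itv_opp => /dH/is_nabla_derive_opp.
  by rewrite opprK.
- move=> [F dF ->]; exists (fun x => - F (- x)); last by rewrite opprK addrC.
  move=> t Kt; apply/is_nabla_derive_opp.
  have -> : (fun x => - - F (- - x)) = F by apply/funext => x; rewrite !opprK.
  by rewrite -[in f t](opprK t); apply: dF; rewrite ts_itv_opp ts_oppK.
Qed.

Lemma within_continuous_opp (R : realType) (K : set R) (f : R -> R) :
  {within K, continuous f} -> {within ts_opp K, continuous (fun x => f (- x))}.
Proof.
move=> /within_continuousP cf; apply/within_continuousP => t Kt e e0.
have [r r0 h] := cf _ Kt e e0; exists r => // s Ks st; apply: h => //.
by rewrite -normrN opprD !opprK.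
Qed.

Lemma within_continuous_lin (R : realType) (K : set R) (k : R) (f g : R -> R) :
  {within K, continuous f} -> {within K, continuous g} ->
  {within K, continuous (fun x => f x + k * g x)}.
Proof.
move=> cf cg x; apply: cvgD; first exact: cf.
by apply: cvgM; [exact: cvg_cst|exact: cg].
Qed.

(** * The integrals as positive linear functionals *)

Lemma delta_int_lin (R : realType) (T : set R) (a b k : R) (f g : R -> R) :
  time_scale T -> T a -> T b -> a <= b ->
  {within ts_itv T a b, continuous f} -> {within ts_itv T a b, continuous g} ->
  delta_int T a b (fun x => f x + k * g x) =
  delta_int T a b f + k * delta_int T a b g.
Proof.
move=> tsT Ta Tb ab cf cg.
have [F dF] := delta_antiderivative_exists tsT Ta ab cf.
have [G dG] := delta_antiderivative_exists tsT Ta ab cg.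
rewrite (delta_intE _ _ _ _ dF)// (delta_intE _ _ _ _ dG)//.
rewrite (delta_intE _ _ _ _ (delta_antiderivative_lin k dF dG))//; ring.
Qed.

Lemma delta_int_ge0 (R : realType) (T : set R) (a b : R) (f : R -> R) :
  time_scale T -> T a -> T b -> a <= b ->
  {within ts_itv T a b, continuous f} ->
  (forall t, ts_itv T a b t -> 0 <= f t) -> 0 <= delta_int T a b f.
Proof.
move=> tsT Ta Tb ab cf f0.
have [F dF] := delta_antiderivative_exists tsT Ta ab cf.
rewrite (delta_intE _ _ _ _ dF)// subr_ge0.
exact: (delta_antiderivative_le tsT Ta Tb ab dF f0).
Qed.

Lemma diamond_int_lin (R : realType) (T : set R) (alpha a b k : R)
    (f g : R -> R) :
  time_scale T -> T a -> T b -> a <= b ->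
  {within ts_itv T a b, continuous f} -> {within ts_itv T a b, continuous g} ->
  diamond_int T alpha a b (fun x => f x + k * g x) =
  diamond_int T alpha a b f + k * diamond_int T alpha a b g.
Proof.
move=> tsT Ta Tb ab cf cg; rewrite /diamond_int !nabla_intE !delta_int_lin//.
- by ring.
- exact: time_scale_opp.
- by rewrite ts_oppK.
- by rewrite ts_oppK.
- by rewrite lerN2.
- by rewrite ts_itv_opp; exact: within_continuous_opp.
- by rewrite ts_itv_opp; exact: within_continuous_opp.
Qed.

Lemma diamond_int_ge0 (R : realType) (T : set R) (alpha a b : R) (f : R -> R) :
  time_scale T -> T a -> T b -> a <= b -> 0 <= alpha <= 1 ->
  {within ts_itv T a b, continuous f} ->
  (forall t, ts_itv T a b t -> 0 <= f t) -> 0 <= diamond_int T alpha a b f.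
Proof.
move=> tsT Ta Tb ab /andP[a0 a1] cf f0.
rewrite /diamond_int nabla_intE addr_ge0// mulr_ge0 ?subr_ge0 ?delta_int_ge0//.
- exact: time_scale_opp.
- by rewrite ts_oppK.
- by rewrite ts_oppK.
- by rewrite lerN2.
- by rewrite ts_itv_opp; exact: within_continuous_opp.
- by move=> t; rewrite ts_itv_opp; exact: f0.
Qed.

(** * Jensen's inequality *)

Lemma convex_three_points (R : realType) (c d : R) (f : R -> R) (x m y : R) :
  convex_function (`]c, d[%classic : set R^o) (f : R^o -> R^o) ->
  c < x -> x < m -> m < y -> y < d ->
  (y - x) * f m <= (y - m) * f x + (m - x) * f y.
Proof.
move=> cf cx xm my yd; have xy : 0 < y - x by lra.
pose p := (y - m) / (y - x).
have p0 : 0 <= p by rewrite divr_ge0; lra.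
have p1 : p <= 1 by rewrite ler_pdivrMr// mul1r; lra.
have px : p * (y - x) = y - m by rewrite divfK// lt0r_neq0.
have xcd : x \in (`]c, d[%classic : set R) by rewrite inE /= in_itv /=; lra.
have ycd : y \in (`]c, d[%classic : set R) by rewrite inE /= in_itv /=; lra.
have h : f (p * x + (1 - p) * y) <= p * f x + (1 - p) * f y.
  exact: (cf (Itv01 p0 p1) x y xcd ycd).
move: h; have -> : p * x + (1 - p) * y = m by lra.
move=> h; have := ler_wpM2l (ltW xy) h; nra.
Qed.

(** The slope of the line is the supremum of the slopes of the chords that end
    at [m] from the left; it is bounded by the slope of any chord that starts
    at [m] to the right. *)
Lemma convex_support_line (R : realType) (c d m : R) (f : R -> R) :
  convex_function (`]c, d[%classic : set R^o) (f : R^o -> R^o) ->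
  c < m < d ->
  exists k, forall y, c < y < d -> f m + k * (y - m) <= f y.
Proof.
move=> cf /andP[cm md].
pose slope x := (f m - f x) / (m - x).
pose A := [set slope x | x in `]c, m[%classic].
have slope_le x y : c < x -> x < m -> m < y -> y < d ->
    slope x <= (f y - f m) / (y - m).
  move=> cx xm my yd; rewrite /slope ler_pdivrMr ?subr_gt0//.
  rewrite mulrAC ler_pdivlMr ?subr_gt0//.
  have := convex_three_points cf cx xm my yd; nra.
have ubA y : m < y -> y < d -> ubound A ((f y - f m) / (y - m)).
  move=> my yd _ [x xcm <-]; move: xcm; rewrite /= in_itv /= => /andP[cx xm].
  exact: slope_le.
have A0 : A !=set0.
  exists (slope ((c + m) / 2)); exists ((c + m) / 2) => //=.
  by rewrite in_itv /=; lra.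
exists (sup A) => y /andP[cy yd]; have [ym|my|->] := ltgtP y m.
- have : slope y <= sup A.
    apply: ub_le_sup; last by exists y => //=; rewrite in_itv /= cy.
    by exists ((f ((m + d) / 2) - f m) / ((m + d) / 2 - m)); apply: ubA; lra.
  rewrite /slope ler_pdivrMr ?subr_gt0//; lra.
- have : sup A <= (f y - f m) / (y - m) by apply: ge_sup => //; exact: ubA.
  rewrite ler_pdivlMr ?subr_gt0//; lra.
- by rewrite subrr mulr0 addr0.
Qed.

Unset Implicit Arguments.

Theorem theorem115 (R : realType) (T : set R) (a b c d alpha : R)
    (g h f : R -> R)
    (hT : time_scale T) (ha : T a) (hb : T b) (hab : a < b)
    (halpha : 0 <= alpha <= 1)
    (hg : {within ts_itv T a b, continuous g})
    (hgcd : forall t, ts_itv T a b t -> c < g t < d)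
    (hh : {within ts_itv T a b, continuous h})
    (hhpos : 0 < diamond_int T alpha a b (fun s => `|h s|))
    (hf : {within `]c, d[%classic, continuous f})
    (hfconv : convex_function (`]c, d[%classic : set R^o) (f : R^o -> R^o)) :
  f (diamond_int T alpha a b (fun s => `|h s| * g s)
       / diamond_int T alpha a b (fun s => `|h s|))
  <= diamond_int T alpha a b (fun s => `|h s| * f (g s))
       / diamond_int T alpha a b (fun s => `|h s|).
Proof.
set K := ts_itv T a b in hg hgcd hh *.
have ab := ltW hab.
have K0 : K !=set0 by exists a; apply/ts_itvP.
have cK : compact K by exact: ts_itv_compact.
have ch : {within K, continuous (fun s => `|h s|)}.
  by move=> x; apply: (continuous_comp (hh x)); exact: norm_continuous.
have cfg : {within K, continuous (fun s => f (g s))}.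
  apply/within_continuousP => t Kt e e0.
  have gt : `]c, d[%classic (g t) by rewrite /= in_itv /=; exact: hgcd.
  have [r r0 fr] := (within_continuousP _ _).1 hf _ gt e e0.
  have [q q0 gq] := (within_continuousP _ _).1 hg _ Kt r r0.
  exists q => // s Ks st; apply: fr; last exact: gq.
  by rewrite /= in_itv /=; exact: hgcd.
have chM u : {within K, continuous u} ->
    {within K, continuous (fun s => `|h s| * u s)}.
  by move=> cu x; apply: cvgM; [exact: ch|exact: cu].
(* Positivity and linearity together, in the only form used: a nonnegative
   combination of [f o g], [g] and [1] keeps its sign when each function is
   replaced by its integral with weight [|h|]. *)
have I_ge0 k0 k1 k2 :
  (forall t, K t -> 0 <= k0 * f (g t) + k1 * g t + k2) ->
  0 <= k0 * diamond_int T alpha a b (fun s => `|h s| * f (g s))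
       + k1 * diamond_int T alpha a b (fun s => `|h s| * g s)
       + k2 * diamond_int T alpha a b (fun s => `|h s|).
  move=> k_ge0; set u := fun s => `|h s| * f (g s).
  have cu : {within K, continuous u} by exact: chM.
  have cv := chM _ hg; set v := fun s => _ in cv *.
  have c1 : {within K, continuous (fun s => u s + (k0 - 1) * u s)}.
    exact: within_continuous_lin.
  have c2 : {within K, continuous (fun s => u s + (k0 - 1) * u s + k1 * v s)}.
    exact: within_continuous_lin.
  (* The multiple [k0 * u] is written [u + (k0 - 1) * u] to fit the shape of
     [diamond_int_lin]. *)
  have -> : k0 * diamond_int T alpha a b u + k1 * diamond_int T alpha a b v
      + k2 * diamond_int T alpha a b (fun s => `|h s|)
    = diamond_int T alpha a b
        (fun s => u s + (k0 - 1) * u s + k1 * v s + k2 * `|h s|).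
    by rewrite !diamond_int_lin//; ring.
  apply: diamond_int_ge0 => //; first exact: within_continuous_lin.
  move=> t Kt; rewrite /u /v.
  have -> : `|h t| * f (g t) + (k0 - 1) * (`|h t| * f (g t))
      + k1 * (`|h t| * g t) + k2 * `|h t|
    = `|h t| * (k0 * f (g t) + k1 * g t + k2) by ring.
  by rewrite mulr_ge0// k_ge0.
set H := diamond_int T alpha a b (fun s => `|h s|) in hhpos I_ge0 *.
set G := diamond_int T alpha a b (fun s => `|h s| * g s) in I_ge0 *.
set F := diamond_int T alpha a b (fun s => `|h s| * f (g s)) in I_ge0 *.
have [s1 /set_mem Ks1 g1] := compact_EVT_min K0 cK hg.
have [s2 /set_mem Ks2 g2] := compact_EVT_max K0 cK hg.
have /andP[cg1 _] := hgcd _ Ks1; have /andP[_ g2d] := hgcd _ Ks2.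
have mcd : c < G / H < d.
  have l1 := I_ge0 0 1 (- g s1).
  have l2 := I_ge0 0 (- 1) (g s2).
  rewrite ltr_pdivlMr// ltr_pdivrMr//; apply/andP; split.
    apply: (@lt_le_trans _ _ (g s1 * H)); first by rewrite ltr_pM2r.
    by have := l1 ltac:(move=> t /mem_set/g1; lra); lra.
  apply: (@le_lt_trans _ _ (g s2 * H)); last by rewrite ltr_pM2r.
  by have := l2 ltac:(move=> t /mem_set/g2; lra); lra.
have [k fk] := convex_support_line hfconv mcd.
set m := G / H in mcd fk *.
have GE : G = m * H by rewrite /m divfK// lt0r_neq0.
rewrite ler_pdivlMr//.
have := I_ge0 1 (- k) (k * m - f m) ltac:(move=> t /hgcd/fk; lra).
by rewrite GE; lra.
Qed.
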